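(* Let $n_1,n_2$ be positive integers and consider the triple $(\mathrm{Sp}(2n_1n_2),\,2\,\mathrm{Sp}(n_1n_2),\,2n_2\,\mathrm{Sp}(n_1))$. Let $2n_2\,\mathfrak{sp}(n_1)\subset\mathfrak{sp}(2n_1n_2)$ be the Lie algebra of $2n_2\,\mathrm{Sp}(n_1)$. Then there exist involutions $\theta_i$, $1\le i\le 2n_2-1$, of the Lie algebra $\mathfrak{sp}(2n_1n_2)$ such that $\theta_i\theta_j=\theta_j\theta_i$ for all $i,j$ and $$2n_2\,\mathfrak{sp}(n_1)=\{x\in\mathfrak{sp}(2n_1n_2)\mid \theta_i(x)=x \text{ for all } 1\le i\le 2n_2-1\}.$$
   Context: $\mathrm{Sp}(n)$ is the compact symplectic group, i.e. the group of $n\times n$ quaternionic matrices $A$ with $A^*A=I$, and $\mathfrak{sp}(n)$ is its Lie algebra of quaternionic skew-Hermitian $n\times n$ matrices. For a positive integer $m$, $m\,\mathrm{Sp}(n)$ denotes the product of $m$ copies of $\mathrm{Sp}(n)$ and $m\,\mathfrak{sp}(n)$ the direct sum of $m$ copies of $\mathfrak{sp}(n)$. The subgroups $2n_2\,\mathrm{Sp}(n_1)\subset 2\,\mathrm{Sp}(n_1n_2)\subset\mathrm{Sp}(2n_1n_2)$ are embedded block-diagonally. An involution of a Lie algebra is a Lie algebra automorphism of order $2$. *)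

(* Defs.v *)
From HB Require Import structures.
From mathcomp Require Import all_boot all_order all_algebra.
From mathcomp Require Import ring.
From mathcomp Require Import boolp classical_sets reals.

Set Implicit Arguments.
Unset Strict Implicit.
Unset Printing Implicit Defensive.

Import GRing.Theory.

Local Open Scope ring_scope.

(* The quaternion [Quat a b c d] is a + b i + c j + d k. *)
Record quat (R : Type) := Quat { qre : R; qi : R; qj : R; qk : R }.

Section Quaternions.
Variable R : realType.

Definition quat_tuple (q : quat R) : R * R * R * R :=
  (qre q, qi q, qj q, qk q).
Definition tuple_quat (t : R * R * R * R) : quat R :=
  let: (a, b, c, d) := t in Quat a b c d.

Lemma quat_tupleK : cancel quat_tuple tuple_quat.
Proof. by case. Qed.

HB.instance Definition _ := Equality.copy (quat R) (can_type quat_tupleK).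
HB.instance Definition _ := Choice.copy (quat R) (can_type quat_tupleK).

Definition zeroq : quat R := Quat 0 0 0 0.
Definition oneq : quat R := Quat 1 0 0 0.
Definition addq (x y : quat R) : quat R :=
  Quat (qre x + qre y) (qi x + qi y) (qj x + qj y) (qk x + qk y).
Definition oppq (x : quat R) : quat R :=
  Quat (- qre x) (- qi x) (- qj x) (- qk x).
Definition scaleq (r : R) (x : quat R) : quat R :=
  Quat (r * qre x) (r * qi x) (r * qj x) (r * qk x).
Definition mulq (x y : quat R) : quat R :=
  Quat (qre x * qre y - qi x * qi y - qj x * qj y - qk x * qk y)
       (qre x * qi y + qi x * qre y + qj x * qk y - qk x * qj y)
       (qre x * qj y - qi x * qk y + qj x * qre y + qk x * qi y)
       (qre x * qk y + qi x * qj y - qj x * qi y + qk x * qre y).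
Definition conjq (x : quat R) : quat R :=
  Quat (qre x) (- qi x) (- qj x) (- qk x).

Ltac quat_ring := rewrite /addq /oppq /scaleq /mulq /=; congr Quat; ring.

Fact addqA : associative addq.
Proof. move=> x y z; quat_ring. Qed.
Fact addqC : commutative addq.
Proof. move=> x y; quat_ring. Qed.
Fact add0q : left_id zeroq addq.
Proof. by case=> a b c d; quat_ring. Qed.
Fact addNq : left_inverse zeroq oppq addq.
Proof. move=> x; quat_ring. Qed.

HB.instance Definition _ :=
  GRing.isZmodule.Build (quat R) addqA addqC add0q addNq.

Fact mulqA : associative mulq.
Proof. move=> x y z; quat_ring. Qed.
Fact mul1q : left_id oneq mulq.
Proof. by case=> a b c d; quat_ring. Qed.
Fact mulq1 : right_id oneq mulq.
Proof. by case=> a b c d; quat_ring. Qed.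
Fact mulqDl : left_distributive mulq addq.
Proof. move=> x y z; quat_ring. Qed.
Fact mulqDr : right_distributive mulq addq.
Proof. move=> x y z; quat_ring. Qed.
Fact oneq_neq0 : oneq != zeroq.
Proof. by apply/eqP => -[] /eqP; rewrite oner_eq0. Qed.

HB.instance Definition _ := GRing.Zmodule_isNzRing.Build (quat R)
  mulqA mul1q mulq1 mulqDl mulqDr oneq_neq0.

Fact scaleqA (a b : R) x : scaleq a (scaleq b x) = scaleq (a * b) x.
Proof. quat_ring. Qed.
Fact scale1q : left_id 1 scaleq.
Proof. by case=> a b c d; quat_ring. Qed.
Fact scaleqDr : right_distributive scaleq addq.
Proof. move=> a x y; quat_ring. Qed.
Fact scaleqDl x (a b : R) : scaleq (a + b) x = addq (scaleq a x) (scaleq b x).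
Proof. quat_ring. Qed.

HB.instance Definition _ := GRing.Zmodule_isLmodule.Build R (quat R)
  scaleqA scale1q scaleqDr scaleqDl.

Fact scaleqAl (a : R) (x y : quat R) :
  scaleq a (mulq x y) = mulq (scaleq a x) y.
Proof. quat_ring. Qed.

HB.instance Definition _ := GRing.Lmodule_isLalgebra.Build R (quat R) scaleqAl.

Fact scaleqAr (a : R) (x y : quat R) :
  scaleq a (mulq x y) = mulq x (scaleq a y).
Proof. quat_ring. Qed.

HB.instance Definition _ := GRing.Lalgebra_isAlgebra.Build R (quat R) scaleqAr.

Fact conjq_is_additive : {morph conjq : x y / x - y}.
Proof.
move=> x y; change (conjq (addq x (oppq y)) = addq (conjq x) (oppq (conjq y))).
rewrite /conjq; quat_ring.
Qed.

HB.instance Definition _ :=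
  GRing.isZmodMorphism.Build (quat R) (quat R) conjq conjq_is_additive.

Fact conjqM x y : conjq (x * y) = conjq y * conjq x.
Proof.
change (conjq (mulq x y) = mulq (conjq y) (conjq x)); rewrite /conjq; quat_ring.
Qed.

Fact conjqZ (a : R) x : conjq (a *: x) = a *: conjq x.
Proof.
change (conjq (scaleq a x) = scaleq a (conjq x)); rewrite /conjq; quat_ring.
Qed.

End Quaternions.

HB.mixin Record Lmodule_isLieAlgebra (R : comNzRingType) L
    of GRing.Lmodule R L := {
  lie : L -> L -> L;
  lieDl : left_distributive lie +%R;
  lieDr : right_distributive lie +%R;
  lieZl : forall (a : R) x y, lie (a *: x) y = a *: lie x y;
  lieZr : forall (a : R) x y, lie x (a *: y) = a *: lie x y;
  liexx : forall x, lie x x = 0;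
  lie_jacobi : forall x y z,
    lie x (lie y z) + lie y (lie z x) + lie z (lie x y) = 0
}.

#[short(type="lieAlgType")]
HB.structure Definition LieAlgebra (R : comNzRingType) :=
  { L of GRing.Lmodule R L & Lmodule_isLieAlgebra R L }.

Definition lie_automorphism (R : comNzRingType) (L : lieAlgType R)
    (f : L -> L) : Prop :=
  [/\ linear f, bijective f & {morph f : x y / lie x y}].

(* an automorphism of order exactly 2: the identity is excluded *)
Definition lie_involution (R : comNzRingType) (L : lieAlgType R)
    (f : L -> L) : Prop :=
  [/\ lie_automorphism f, involutive f & exists x, f x <> x].

Section CompactSymplectic.
Variable R : realType.

Definition adjmx (m n : nat) (x : 'M[quat R]_(m, n)) : 'M[quat R]_(n, m) :=
  (map_mx (@conjq R) x)^T.

Definition skewHermitian (n : nat) (x : 'M[quat R]_n) : bool := adjmx x == - x.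

Record sp (n : nat) := Sp { spval :> 'M[quat R]_n; _ : skewHermitian spval }.

HB.instance Definition _ n := [isSub for @spval n].
HB.instance Definition _ n := [Choice of sp n by <:].

Section SpLie.
Variable n : nat.

Fact adjmxB (x y : 'M[quat R]_n) : adjmx (x - y) = adjmx x - adjmx y.
Proof. by rewrite /adjmx map_mxB linearB. Qed.

Fact adjmxM (x y : 'M[quat R]_n) : adjmx (x *m y) = adjmx y *m adjmx x.
Proof.
apply/matrixP => i j; rewrite !mxE raddf_sum /=.
by apply: eq_bigr => k _; rewrite !mxE conjqM.
Qed.

Fact skewHermitian_zmod_closed : zmod_closed (@skewHermitian n).
Proof.
split=> [|x y /eqP xE /eqP yE]; apply/eqP.
  by rewrite -(subrr 0) adjmxB !subrr oppr0.
by rewrite adjmxB xE yE -opprD.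
Qed.

HB.instance Definition _ :=
  GRing.isZmodClosed.Build 'M[quat R]_n (@skewHermitian n)
    skewHermitian_zmod_closed.
HB.instance Definition _ := [SubChoice_isSubZmodule of sp n by <:].

(* [r%:A *: x] multiplies every entry of [x] by the real number [r]; the
   scalars of the library's module structure on 'M[quat R]_n are quaternions. *)
Fact skewHermitianZ (r : R) (x : sp n) : skewHermitian (r%:A *: spval x).
Proof.
case: x => x /= /eqP /matrixP xE; apply/eqP/matrixP => i j.
have := xE i j; rewrite !mxE => xij.
by rewrite -!scalerAl !mul1r conjqZ xij scalerN.
Qed.

Definition spscale (r : R) (x : sp n) : sp n := Sp (skewHermitianZ r x).

Fact spscaleA a b x : spscale a (spscale b x) = spscale (a * b) x.
Proof.
by apply: val_inj; rewrite /= scalerA -scalerAl mul1r scalerA.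
Qed.
Fact spscale1 : left_id 1 spscale.
Proof. by move=> x; apply: val_inj; rewrite /= scale1r scale1r. Qed.
Fact spscaleDr : right_distributive spscale +%R.
Proof. by move=> a x y; apply: val_inj; rewrite /= scalerDr. Qed.
Fact spscaleDl x : {morph spscale^~ x : a b / a + b}.
Proof. by move=> a b; apply: val_inj; rewrite /= scalerDl scalerDl. Qed.

HB.instance Definition _ := GRing.Zmodule_isLmodule.Build R (sp n)
  spscaleA spscale1 spscaleDr spscaleDl.

Fact skewHermitian_lie (x y : sp n) :
  skewHermitian (spval x *m spval y - spval y *m spval x).
Proof.
case: x y => x /= /eqP xE [y /= /eqP yE]; apply/eqP.
by rewrite adjmxB !adjmxM xE yE !mulNmx !mulmxN !opprK opprB.
Qed.

Definition splie (x y : sp n) : sp n := Sp (skewHermitian_lie x y).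

Fact splieDl : left_distributive splie +%R.
Proof.
move=> x y z; apply: val_inj; rewrite /= mulmxDl mulmxDr opprD.
by rewrite addrACA.
Qed.
Fact splieDr : right_distributive splie +%R.
Proof.
move=> x y z; apply: val_inj; rewrite /= mulmxDl mulmxDr opprD.
by rewrite addrACA.
Qed.
Fact mulmx_realr (r : R) (x y : 'M[quat R]_n) :
  x *m (r%:A *: y) = r%:A *: (x *m y).
Proof.
apply/matrixP => i j; rewrite !mxE mulr_sumr; apply: eq_bigr => k _.
by rewrite !mxE -!scalerAl !mul1r scalerAr.
Qed.
Fact splieZl (a : R) x y : splie (a *: x) y = a *: splie x y.
Proof.
by apply: val_inj; rewrite /= mulmx_realr -scalemxAl scalerBr.
Qed.
Fact splieZr (a : R) x y : splie x (a *: y) = a *: splie x y.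
Proof.
by apply: val_inj; rewrite /= mulmx_realr -scalemxAl scalerBr.
Qed.
Fact spliexx x : splie x x = 0.
Proof. by apply: val_inj; rewrite /= subrr. Qed.
Fact splie_jacobi x y z :
  splie x (splie y z) + splie y (splie z x) + splie z (splie x y) = 0.
Proof.
have cyclic (V : zmodType) (a b c d e f : V) :
    a - e - (b - d) + (b - f - (c - e)) + (c - d - (a - f)) = 0.
  have swap (s t u v : V) : s - t - (u - v) = (s - u) + (v - t).
    by rewrite opprB addrACA [- t - u]addrC addrACA.
  rewrite (swap a) (swap b) (swap c) [X in X + _]addrACA !subrKA addrACA.
  by rewrite !subrKA !subrr addr0.
apply: val_inj; rewrite /= !mulmxBl !mulmxBr !mulmxA; exact: cyclic.
Qed.

HB.instance Definition _ := Lmodule_isLieAlgebra.Build R (sp n)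
  splieDl splieDr splieZl splieZr spliexx splie_jacobi.

End SpLie.

Fact skewHermitian_castmx (m n : nat) (e : m = n) (x : 'M[quat R]_m) :
  skewHermitian x -> skewHermitian (castmx (e, e) x).
Proof. by case: n / e; rewrite castmx_id. Qed.

Section BlockDiagonal.
Variables m n : nat.

Fact sum_blocks : (\sum_(i < m) n)%N = (m * n)%N.
Proof. by rewrite sum_nat_const card_ord. Qed.

Definition blockdiag_mx (y : {ffun 'I_m -> sp n}) : 'M[quat R]_(m * n) :=
  castmx (sum_blocks, sum_blocks) (\mxdiag_(i < m) spval (y i)).

Fact skewHermitian_blockdiag y : skewHermitian (blockdiag_mx y).
Proof.
apply: skewHermitian_castmx; apply/eqP; rewrite /adjmx -mxdiagN.
apply/mxblockP => i j; rewrite -tr_submxblock /submxblock -map_mxsub.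
rewrite -!/(submxblock _ _ _) !mxblockK.
have [<-|ij] := eqVneq j i; last by rewrite map_mx0 trmx0.
by rewrite !conform_mx_id; case: (y j) => x /= /eqP.
Qed.

Definition blockdiag (y : {ffun 'I_m -> sp n}) : sp (m * n) :=
  Sp (skewHermitian_blockdiag y).

(* The direct sum m sp(n), embedded block-diagonally in sp(mn): the Lie algebra
   of the block-diagonal subgroup m Sp(n) of Sp(mn). *)
Definition msp : set (sp (m * n)) := range blockdiag.

End BlockDiagonal.

End CompactSymplectic.

Arguments msp : clear implicits.

(* Main.v *)
Require Import Defs.
From mathcomp Require Import all_boot all_order all_algebra.
From mathcomp Require Import boolp classical_sets reals.

Set Implicit Arguments.
Unset Strict Implicit.

(* Conjugation by a diagonal matrix with entries 1 and -1 is an involution of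
   sp(N), it fixes exactly the matrices that commute with that diagonal matrix,
   and two such conjugations commute. Let theta_i be the conjugation that negates
   the i-th block of coordinates. All but one of the blocks suffice: of two
   distinct blocks at least one is negated by some theta_i that preserves the
   other, hence an x fixed by all theta_i has no entry linking the two. *)

Import GRing.Theory.

Local Open Scope classical_set_scope.
Local Open Scope ring_scope.

Section SignConjugation.
Variables (R : realType) (N : nat).
Implicit Types (p q : pred 'I_N) (x y : sp R N).

Definition signmx p : 'M[quat R]_N := diag_mx (\row_k (-1) ^+ p k).


Lemma conjq1 : conjq (1 : quat R) = 1.
Proof. by congr Quat; rewrite oppr0. Qed.

Lemma adjmx_signmx p : adjmx (signmx p) = signmx p.
Proof.
apply/matrixP => a b; rewrite !mxE eq_sym.
have [->|] := eqVneq; last by rewrite raddf0.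
by rewrite !mulr1n; case: (p b); rewrite ?raddfN /= conjq1.
Qed.

Lemma signmxK p : signmx p *m signmx p = 1%:M.
Proof.
rewrite mulmx_diag -diag_const_mx; congr diag_mx.
by apply/rowP => k; rewrite !mxE -signr_addb addbb.
Qed.

Fact skewHermitian_signconj p x :
  skewHermitian (signmx p *m spval x *m signmx p).
Proof.
case: x => x /= /eqP xE; apply/eqP.
by rewrite !adjmxM !adjmx_signmx xE mulNmx mulmxN mulmxA.
Qed.

Definition signconj p x : sp R N := Sp (skewHermitian_signconj p x).

(** The row and column factors are signs, hence central among the quaternions, and merge into a
    single sign. Most facts below are checked on entries in this form. *)
Lemma signconjE p x a b : signconj p x a b = (-1) ^+ (p a (+) p b) * x a b.
Proof.
rewrite /= /signmx mul_mx_diag mxE mul_diag_mx !mxE signr_addb -!mulrA.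
by rewrite [X in _ * X = _](commr_sign _ (p b)).
Qed.

Lemma spP x y : (forall a b, x a b = y a b) -> x = y.
Proof. by move=> xy; apply/val_inj/matrixP. Qed.

Lemma signconj_comm p q : signconj p \o signconj q =1 signconj q \o signconj p.
Proof.
move=> x; apply: spP => a b.
by rewrite [LHS]signconjE [RHS]signconjE !signconjE !mulrA -!signr_addb addbC.
Qed.

Lemma signconjK p : involutive (signconj p).
Proof.
by move=> x; apply: spP => a b; rewrite !signconjE mulrA -signr_addb addbb mul1r.
Qed.

Lemma signconj_linear p : linear (signconj p).
Proof.
move=> r x y; apply: val_inj.
by rewrite /= mulmxDr mulmxDl mulmx_realr -scalemxAl.
Qed.

Lemma signconj_lie p : {morph signconj p : x y / lie x y}.
Proof.
have conjM (u v : 'M_N) : signmx p *m u *m signmx p *m (signmx p *m v *m signmx p)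
    = signmx p *m (u *m v) *m signmx p.
  by rewrite !mulmxA -(mulmxA _ (signmx p) (signmx p)) signmxK mulmx1.
by move=> x y; apply: val_inj; rewrite /= mulmxBr mulmxBl !conjM.
Qed.

Lemma signconj_automorphism p : lie_automorphism (signconj p).
Proof.
split; [exact: signconj_linear | | exact: signconj_lie].
exact: inv_bij (signconjK p).
Qed.

(** The real scalar 2 is invertible, so no quaternion inverse enters. This kills an entry that a
    sign conjugation both negates and fixes. *)
Lemma quat_eqN (z : quat R) : - z = z -> z = 0.
Proof.
move=> zN; have : (2%:R : R) *: z = 0.
  by rewrite scaler_nat mulr2n -{1}zN addNr.
move/(congr1 ( *:%R 2%:R^-1)); rewrite scaler0 scalerA mulVf ?scale1r //.
by rewrite Num.Theory.pnatr_eq0.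
Qed.

Lemma signconj_fixP p x :
  signconj p x = x <-> forall a b, p a != p b -> x a b = 0.
Proof.
split=> [xp a b pab | x0].
  by apply: quat_eqN; rewrite -{2}xp signconjE -negb_eqb pab mulN1r.
apply: spP => a b; rewrite signconjE -negb_eqb.
by have [|/x0 ->] := eqVneq (p a) (p b); rewrite /= ?mul1r ?mulr0.
Qed.

(** These matrices witness that a sign conjugation is not the identity: if [p] separates [a] from
    [b], the entry 1 at [(a, b)] changes sign. *)
Fact skewHermitian_delta (a b : 'I_N) :
  skewHermitian (delta_mx a b - delta_mx b a : 'M[quat R]_N).
Proof.
have adj_delta i j : adjmx (delta_mx i j : 'M[quat R]_N) = delta_mx j i.
  apply/matrixP => k l; rewrite !mxE andbC.
  by case: (_ && _); rewrite ?conjq1 ?raddf0.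
by apply/eqP; rewrite adjmxB !adj_delta opprB.
Qed.

Lemma signconj_involution p a b : p a != p b -> lie_involution (signconj p).
Proof.
move=> pab; split; [exact: signconj_automorphism | exact: signconjK |].
have ab : a != b by apply: contraNneq pab => ->.
exists (Sp (skewHermitian_delta a b)) => /signconj_fixP /(_ a b pab).
rewrite /= !mxE !eqxx (negPf ab) subr0; apply/eqP; exact: oner_neq0.
Qed.

End SignConjugation.

Section Blocks.
Variables (R : realType) (m n : nat).

(** Undoes the cast of [blockdiag_mx], so that blocks agree with those of [\mxdiag]. *)
Definition block (k : 'I_(m * n)) : 'I_m :=
  tagnat.sig1 (cast_ord (esym (sum_blocks m n)) k).

Lemma block_surj (i : 'I_m) : (0 < n)%N -> exists k, block k = i.
Proof.
move=> n_gt0; exists (cast_ord (sum_blocks m n) (tagnat.Rank (p_ := fun=> n) i (Ordinal n_gt0))).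
by rewrite /block cast_ordK tagnat.Rank1K.
Qed.

Lemma blockdiag_offdiag (y : {ffun 'I_m -> sp R n}) a b :
  block a != block b -> blockdiag y a b = 0.
Proof. by move=> ab; rewrite /= castmxE mxE /= (negPf ab) mxE. Qed.

Lemma mspP (x : sp R (m * n)) :
  msp R m n x <-> forall a b, block a != block b -> x a b = 0.
Proof.
split=> [[y _ <-] a b | x0]; first exact: blockdiag_offdiag.
have e := sum_blocks m n.
(* [emb i j] is the [j]-th index of block [i]. The preimage of [x] under [blockdiag] consists of its
   principal submatrices on the blocks. *)
pose emb (i : 'I_m) (j : 'I_n) : 'I_(m * n) :=
  cast_ord e (tagnat.Rank (p_ := fun=> n) i j).
have skew i : skewHermitian (\matrix_(j, k) x (emb i j) (emb i k)).
  case: x {x0} => x /= /eqP/matrixP xE; apply/eqP/matrixP => j k.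
  by have := xE (emb i j) (emb i k); rewrite !mxE.
exists [ffun i => Sp (skew i)] => //; apply: spP => a b.
have [ab|ab] := eqVneq (block a) (block b); last first.
  by rewrite x0 // blockdiag_offdiag.
(* The block enters through an equation because, after rewriting with [ab], the index [a] is located
   relative to [block b]. *)
have embK i c : i = block c ->
    emb i (tagnat.sig2 (cast_ord (esym (sum_blocks m n)) c)) = c.
  by move=> ->; rewrite /emb /block tagnat.sig2K; apply: val_inj.
rewrite /= castmxE mxE /= -!/(block _) ab eqxx conform_mx_id ffunE mxE.
by rewrite !embK.
Qed.

End Blocks.

Theorem theorem1p4 (R : realType) (n1 n2 : nat)
    (n1_gt0 : (0 < n1)%N) (n2_gt0 : (0 < n2)%N) :
  exists theta : 'I_(2 * n2 - 1) -> sp R (2 * n2 * n1)%N -> sp R (2 * n2 * n1)%N,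
    [/\ forall i, lie_involution (theta i),
        forall i j, theta i \o theta j =1 theta j \o theta i &
        msp R (2 * n2)%N n1 = [set x | forall i, theta i x = x]].
Proof.
have m_gt1 : (1 < 2 * n2)%N by rewrite (leq_mul2l 2 1).
move: (2 * n2)%N m_gt1 => m m_gt1.
(* The range of [wid] omits the last block, of index [m - 1], which is therefore never negated. *)
pose wid (i : 'I_(m - 1)) : 'I_m := widen_ord (leq_subr 1 m) i.
have last_lt : (m - 1 < m)%N by rewrite ltn_subrL (ltnW m_gt1).
pose neg i (k : 'I_(m * n1)) := block k == wid i.
exists (fun i => signconj (neg i)); split=> [i | i j |].
- have [a aE] := block_surj (wid i) n1_gt0.
  have [b bE] := block_surj (Ordinal last_lt) n1_gt0.
  (* The conjugation is nontrivial since [a] lies in the negated block and [b] in the last one. *)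
  apply: (@signconj_involution _ _ _ a b).
  by rewrite /neg aE bE eqxx eq_sym eqb_id -val_eqE /= gtn_eqF.
- exact: signconj_comm.
apply/seteqP; split=> x.
  move=> /mspP x0 i; apply/signconj_fixP => a b ab; apply: x0.
  by apply: contraNneq ab; rewrite /neg => ->.
move=> xfix; apply/mspP => a b ab.
(* Take the block of [a] unless it is the last; then the block of [b] is not the last and serves
   instead. *)
have [i neg_ab] : exists i, neg i a != neg i b.
  have [alt | age] := ltnP (block a) (m - 1).
    have aE : wid (Ordinal alt) = block a by apply: val_inj.
    by exists (Ordinal alt); rewrite /neg aE eqxx eq_sym eqb_id eq_sym.
  have blt : (block b < m - 1)%N.
    have leM (k : 'I_m) : (k <= m - 1)%N by rewrite subn1 -ltnS (ltn_predK m_gt1).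
    rewrite ltn_neqAle leM andbT; apply: contraNneq ab => bE.
    by rewrite -val_eqE /= bE eqn_leq leM.
  have bE : wid (Ordinal blt) = block b by apply: val_inj.
  by exists (Ordinal blt); rewrite /neg bE eqxx eqb_id.
by have /signconj_fixP := xfix i; apply.
Qed.
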